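(* Let $\lambda=\{\lambda_n\}_{n\in\mathbb{N}}$ and $\rho=\{\rho_n\}_{n\in\mathbb{N}}$ be positive sequences, where $\lambda$ is such that the functions $w_n=\sqrt{\lambda_n}\,v_n$ form a complete orthonormal system of $\mathcal{H}(C)$, so that the native space $\mathcal{H}(C)$ is $L_{2,\lambda}(\Omega)$. If $\sum_{n=1}^\infty \lambda_n\rho_n^{-1}<\infty$, then the native space $L_{2,\lambda}(\Omega)$ lies in $L_{2,\rho}(\Omega)$.
   Context: $\Omega\subset\mathbb{R}^d$ is a bounded domain, $C:\Omega\times\Omega\to\mathbb{R}$ is a continuous, symmetric, positive definite kernel, and $\mathcal{H}(C)$ is its reproducing kernel Hilbert space (native space). $\{v_n\}_{n\in\mathbb{N}}$ is a fixed orthonormal basis of $L_2(\Omega)$. For a positive sequence $\rho=\{\rho_n\}_{n\in\mathbb{N}}$, the space $L_{2,\rho}(\Omega)$ consists of all $f\in L_2(\Omega)$ with $\sum_{n=1}^\infty (f,v_n)_{L_2(\Omega)}^2\rho_n^{-1}<\infty$, with inner product $$(f,g)_{L_{2,\rho}(\Omega)}=\sum_{n=1}^\infty (f,v_n)_{L_2(\Omega)}(g,v_n)_{L_2(\Omega)}\rho_n^{-1}.$$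
   Formalization: The identification of H(C) with L_{2,λ}(Ω), and H(C) lying in L_{2,ρ}(Ω), are stated assuming H(C) is contained in L_2(Ω), which can fail when C is unbounded near the boundary; L_{2,λ}(Ω) lying in L_{2,ρ}(Ω) is unconditional. *)

(* Defs.v *)
From HB Require Import structures.
From mathcomp Require Import all_boot all_order all_algebra.
From mathcomp Require Import all_classical all_reals all_analysis.
Set Implicit Arguments.
Unset Strict Implicit.
Unset Printing Implicit Defensive.
Import Order.TTheory GRing.Theory Num.Theory.
Import numFieldNormedType.Exports.
Local Open Scope classical_set_scope.
Local Open Scope ring_scope.

Definition rV_display : measure_display.
Proof. exact: default_measure_display. Qed.

Section measurable_rV.
Context (R : realType) (n : nat).

(* The product (= Borel) sigma-algebra of R^n: the one generated by the
   coordinate functions. *)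
Definition rV_coord (i : 'I_n) (x : 'rV[R]_n) : measurableTypeR R := x ord0 i.

Let rV_set0 : g_sigma_preimage rV_coord set0.
Proof. exact: sigma_algebra0. Qed.

Let rV_setC A : g_sigma_preimage rV_coord A -> g_sigma_preimage rV_coord (~` A).
Proof. exact: sigma_algebraC. Qed.

Let rV_bigcup (F : _^nat) : (forall i, g_sigma_preimage rV_coord (F i)) ->
  g_sigma_preimage rV_coord (\bigcup_i (F i)).
Proof. exact: sigma_algebra_bigcup. Qed.

HB.instance Definition _ := @isMeasurable.Build
  rV_display
  'rV[R]_n (g_sigma_preimage rV_coord) rV_set0 rV_setC rV_bigcup.
End measurable_rV.

Section lebesgue_rV.
Context (R : realType).

Definition rV_cons n (p : measurableTypeR R * 'rV[R]_n) : 'rV[R]_n.+1 :=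
  row_mx (const_mx p.1 : 'rV_1) p.2.

Lemma rV_cons0 n p : rV_coord ord0 (@rV_cons n p) = p.1.
Proof.
rewrite /rV_coord /rV_cons mxE; case: splitP => [j _|j /=]; first by rewrite mxE.
by rewrite add1n.
Qed.

Lemma rV_consS n p (i : 'I_n) :
  rV_coord (lift ord0 i) (@rV_cons n p) = rV_coord i p.2.
Proof.
rewrite /rV_coord /rV_cons mxE; case: splitP => [j /=|j /= [ij]].
- by rewrite ord1.
- by congr (p.2 _ _); apply: val_inj.
Qed.

Lemma measurable_rV_coord n (i : 'I_n) :
  measurable_fun [set: 'rV[R]_n] (@rV_coord R n i).
Proof.
move=> _ Y mY; rewrite setTI; apply: sub_sigma_algebra => /=.
rewrite -bigcup_seq/=; exists i => /=; first by rewrite mem_index_enum.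
by exists Y => //; rewrite setTI.
Qed.

Lemma measurable_rVP d (T : measurableType d) n (f : T -> 'rV[R]_n) :
  (forall i, measurable_fun [set: T] (@rV_coord R n i \o f)) ->
  measurable_fun [set: T] f.
Proof.
move=> mf.
suff H : g_sigma_preimage (fun i => @rV_coord R n i \o f) `<=` measurable.
  by rewrite g_sigma_preimage_comp in H => _ A mA; apply: H; exists A.
apply: smallest_sub; first exact: sigma_algebra_measurable.
by rewrite -bigcup_seq; apply: bigcup_sub => i _ A [B mB <-]; exact: mf.
Qed.

Lemma measurable_rV_cons n : measurable_fun setT (@rV_cons n).
Proof.
apply: measurable_rVP => i; case: (unliftP ord0 i) => [j|] -> {i}.
- rewrite (_ : _ \o _ = @rV_coord R n j \o snd); last first.
    by apply/funext => p /=; rewrite rV_consS.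
  by apply: measurableT_comp; [exact: measurable_rV_coord|exact: measurable_snd].
- rewrite (_ : _ \o _ = fst); first exact: measurable_fst.
  by apply/funext => p /=; rewrite rV_cons0.
Qed.

Definition rV_uncons n (y : 'rV[R]_n.+1) : measurableTypeR R * 'rV[R]_n :=
  (y ord0 ord0, \row_i y ord0 (lift ord0 i)).

Lemma rV_consK n : cancel (@rV_cons n) (@rV_uncons n).
Proof.
move=> p; rewrite [RHS]surjective_pairing; congr pair.
  exact: rV_cons0.
by apply/rowP => i; rewrite mxE; exact: rV_consS.
Qed.

Lemma measurable_rV_uncons n : measurable_fun setT (@rV_uncons n).
Proof.
apply: measurable_fun_pair; first exact: (@measurable_rV_coord n.+1).
apply: measurable_rVP => i.
rewrite (_ : _ \o _ = @rV_coord R n.+1 (lift ord0 i)).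
  exact: measurable_rV_coord.
by apply/funext => y; rewrite /rV_coord /= mxE.
Qed.

Section lebesgue_rV_succ.
Context n (mu : {sigma_finite_measure set 'rV[R]_n -> \bar R}).
Local Open Scope ereal_scope.

Definition lebesgue_rV_succ : set 'rV[R]_n.+1 -> \bar R :=
  pushforward (lebesgue_measure \x mu) (@rV_cons n).

Let succ0 : lebesgue_rV_succ set0 = 0.
Proof. by rewrite /lebesgue_rV_succ /pushforward preimage_set0 measure0. Qed.

Let succ_ge0 A : 0 <= lebesgue_rV_succ A.
Proof. by rewrite /lebesgue_rV_succ /pushforward measure_ge0. Qed.

Let succ_sigma_additive : semi_sigma_additive lebesgue_rV_succ.
Proof.
move=> F mF tF _; rewrite /lebesgue_rV_succ /pushforward preimage_bigcup.
have mcF k : measurable (@rV_cons n @^-1` F k).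
  by rewrite -[X in measurable X]setTI; exact: measurable_rV_cons.
apply: measure_semi_sigma_additive => //; last exact: bigcup_measurable.
apply/trivIsetP => /= i j _ _ ij; rewrite -preimage_setI.
by move/trivIsetP : tF => /(_ _ _ _ _ ij) -> //; rewrite preimage_set0.
Qed.

HB.instance Definition _ := isMeasure.Build _ _ _ lebesgue_rV_succ
  succ0 succ_ge0 succ_sigma_additive.

Let succ_sigma_finite : sigma_finite setT lebesgue_rV_succ.
Proof.
have /sigma_finiteP[F [TF ndF Foo]] := sigma_finiteT (@lebesgue_measure R).
have /sigma_finiteP[G [TG ndG Goo]] := sigma_finiteT mu.
exists (fun k => @rV_uncons n @^-1` (F k `*` G k)).
  apply/seteqP; split => // y _.
  have [i _ Fi] : (\bigcup_i F i) (rV_uncons y).1 by rewrite -TF.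
  have [j _ Gj] : (\bigcup_i G i) (rV_uncons y).2 by rewrite -TG.
  exists (maxn i j) => //; split.
  - by move: Fi; exact/subsetPset/ndF/leq_maxl.
  - by move: Gj; exact/subsetPset/ndG/leq_maxr.
move=> k; have [mF Fk] := Foo k; have [mG Gk] := Goo k; split.
  rewrite -[X in measurable X]setTI; apply: measurable_rV_uncons => //.
  exact: measurableX.
rewrite /lebesgue_rV_succ /pushforward -comp_preimage.
rewrite (_ : _ \o _ = id); last by apply/funext => p; exact: rV_consK.
by rewrite preimage_id product_measure1E// lte_mul_pinfty// ge0_fin_numE.
Qed.

HB.instance Definition _ := Measure_isSigmaFinite.Build _ _ _ lebesgue_rV_succ
  succ_sigma_finite.

End lebesgue_rV_succ.

(* Lebesgue measure on R^n, as the n-fold product of Lebesgue measure on R. *)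
Fixpoint lebesgue_rV n : {sigma_finite_measure set 'rV[R]_n -> \bar R} :=
  match n with
  | 0 => dirac (0 : 'rV[R]_0)
  | k.+1 => lebesgue_rV_succ (lebesgue_rV k)
  end.

End lebesgue_rV.

Section hilbert_space.
Context (R : realType) (V : lmodType R).
Implicit Types (S : set V) (ip : V -> V -> R).

(* [ip] is only constrained on the subspace [S], which is the actual space. *)
Record hilbert_space S ip : Prop := HilbertSpace {
  hilbert0 : S 0 ;
  hilbertZD : forall (a : R) f g, S f -> S g -> S (a *: f + g) ;
  hilbert_ipC : forall f g, S f -> S g -> ip f g = ip g f ;
  hilbert_ipZD : forall (a : R) f g h, S f -> S g -> S h ->
    ip (a *: f + g) h = a * ip f h + ip g h ;
  hilbert_ip_ge0 : forall f, S f -> 0 <= ip f f ;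
  hilbert_ip_eq0 : forall f, S f -> ip f f = 0 -> f = 0 ;
  hilbert_complete : forall u : nat -> V, (forall n, S (u n)) ->
    (forall e : R, 0 < e -> exists N, forall m n, (N <= m)%N -> (N <= n)%N ->
       ip (u m - u n) (u m - u n) < e) ->
    exists2 f, S f & (fun n => ip (u n - f) (u n - f)) @ \oo --> (0 : R) }.

Definition complete_orthonormal S ip (e : nat -> V) : Prop :=
  [/\ forall n, S (e n),
      forall m n, ip (e m) (e n) = (m == n)%:R &
      forall f, S f ->
        (fun n => let r := f - \sum_(k < n) ip f (e k) *: e k in ip r r)
          @ \oo --> (0 : R)].

End hilbert_space.

Section spaces.
Context (R : realType) (d : nat).
Local Notation Rd := 'rV[R]_d.
Implicit Types (Om : set Rd) (C : Rd -> Rd -> R) (v : nat -> Rd -> R)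
  (rho : nat -> R) (H : set (Rd -> R)) (ip : (Rd -> R) -> (Rd -> R) -> R).

Definition bounded_domain Om : Prop :=
  [/\ open Om, connected Om, Om !=set0 & bounded_set Om].

(* In the sense of Aronszajn and Mercer: the kernel matrices are positive
   semidefinite.  Strictly positive definite kernels are thus included. *)
Definition positive_definite_kernel Om C : Prop :=
  forall (n : nat) (x : 'I_n -> Rd) (a : 'I_n -> R), (forall i, Om (x i)) ->
    0 <= \sum_(i < n) \sum_(j < n) a i * a j * C (x i) (x j).

(* A function on Om is represented by its extension by zero to R^d (the library
   notation [f \_ Om]).  By the Moore-Aronszajn theorem, C determines H, and ip
   on H, uniquely. *)
Record native_space Om C H ip : Prop := NativeSpace {
  native_hilbert : hilbert_space H ip ;
  native_supp : forall f, H f -> f \_ Om = f ;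
  native_kernel : forall x, Om x -> H (C x \_ Om) ;
  native_reproducing : forall x f, Om x -> H f -> ip f (C x \_ Om) = f x }.

(* L_2(Om) is handled through representatives: equality in L_2(Om) is equality
   almost everywhere on Om, and L2_ip is only semidefinite on L2. *)
Definition L2 Om : set (Rd -> R) :=
  [set f | f \_ Om \in Lfun (lebesgue_rV R d) 2%:E].

Definition L2_ip Om (f g : Rd -> R) : R :=
  \int[lebesgue_rV R d]_(x in Om) (f x * g x).

Definition L2w Om v rho : set (Rd -> R) :=
  [set f | L2 Om f /\
           cvgn (series (fun n => L2_ip Om f (v n) ^+ 2 * (rho n)^-1))].

Definition L2w_ip Om v rho (f g : Rd -> R) : R :=
  limn (series (fun n => L2_ip Om f (v n) * L2_ip Om g (v n) * (rho n)^-1)).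

(* The Hilbert space (H, ip) of functions on Om is L_{2,rho}(Om): taking classes
   modulo equality almost everywhere is an isometry of H onto L_{2,rho}(Om). *)
Definition space_is_L2w Om v rho H ip : Prop :=
  [/\ H `<=` L2w Om v rho,
      forall f g, H f -> H g -> ip f g = L2w_ip Om v rho f g &
      forall f, L2w Om v rho f -> exists2 g, H g &
        {ae lebesgue_rV R d, forall x, Om x -> f x = g x}].

End spaces.

(* Main.v *)
Require Import Defs.
From HB Require Import structures.
From mathcomp Require Import all_boot all_order all_algebra.
From mathcomp Require Import all_classical all_reals all_analysis.
From mathcomp Require Import measurable_realfun.
From mathcomp Require Import ring lra zify.
Set Implicit Arguments.
Unset Strict Implicit.
Unset Printing Implicit Defensive.
Import Order.TTheory GRing.Theory Num.Theory.
Import numFieldNormedType.Exports.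
Local Open Scope classical_set_scope.
Local Open Scope ring_scope.

(** The inclusion between the weighted spaces is a comparison of series: the
    terms lam_n / rho_n of a convergent series are bounded, by B say, and
    (f,v_n)^2 / rho_n <= B (f,v_n)^2 / lam_n ([L2w_sub]).

    The substance lies in identifying H with L_{2,lam}.  Everything follows from
    the formula (f,v_n)_{L_2} = sqrt(lam_n) (f,w_n)_H for f in H
    ([native_L2_coef]): the Parseval identity in H ([parseval]) then gives the
    inner product of L_{2,lam}, and conversely the coefficients
    (f,v_n) / sqrt(lam_n) of an f in L_{2,lam} are square summable, hence are
    those of some g in H ([riesz_fischer]), and g = f almost everywhere since f
    and g have the same coefficients on the complete system v.

    On the finite linear combinations of the w_k the formula is just the
    orthonormality of v, but the partial sums of the expansion of f converge
    in H, so the inclusion of H in L_2 must be shown to be continuous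
    ([native_L2_bounded]).  This is an instance of the closed graph theorem.
    Convergence in H implies pointwise convergence on Om, because the
    evaluations are inner products with the kernel, so by the lemma of Fatou the
    L_2 norm is lower semicontinuous on H ([L2_fatou]).  A finite lower
    semicontinuous seminorm on a complete space is bounded, by the Baire
    category argument; [lsc_form_bounded] carries it out for the square of a
    seminorm that comes from a semi-inner product, with nested balls. *)

(** * Semi-inner products *)

(** As for [hilbert_space], the form is constrained only on the subspace [S].
    Definiteness is dropped so that the theory also covers the L_2 product
    of representatives. *)
Record semi_inner_product (R : realType) (V : lmodType R) (S : set V)
    (b : V -> V -> R) : Prop := SemiInnerProduct {
  sip0 : S 0 ;
  sipZD : forall (a : R) f g, S f -> S g -> S (a *: f + g) ;
  sipC : forall f g, S f -> S g -> b f g = b g f ;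
  sip_linear : forall (a : R) f g h, S f -> S g -> S h ->
    b (a *: f + g) h = a * b f h + b g h ;
  sip_ge0 : forall f, S f -> 0 <= b f f }.

Section semi_inner_product_theory.
Context (R : realType) (V : lmodType R) (S : set V) (b : V -> V -> R).
Hypothesis sb : semi_inner_product S b.

Lemma sip_memD f g : S f -> S g -> S (f + g).
Proof. by move=> Sf Sg; rewrite -[f]scale1r; exact: (sipZD sb). Qed.

Lemma sip_memZ a f : S f -> S (a *: f).
Proof. by move=> Sf; rewrite -[_ *: _]addr0; exact: (sipZD sb _ Sf (sip0 sb)). Qed.

Lemma sip_memB f g : S f -> S g -> S (f - g).
Proof. by move=> Sf Sg; rewrite -scaleN1r; apply: sip_memD => //; exact: sip_memZ. Qed.

Lemma sip_mem_sum (e : nat -> V) (c : nat -> R) n : (forall k, S (e k)) ->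
  S (\sum_(k < n) c k *: e k).
Proof.
move=> Se; elim/big_ind: _ => //; [exact: sip0 sb|exact: sip_memD|].
by move=> i _; exact: sip_memZ.
Qed.

Lemma sipD f g h : S f -> S g -> S h -> b (f + g) h = b f h + b g h.
Proof. by move=> Sf Sg Sh; rewrite -{1}[f]scale1r (sip_linear sb)// mul1r. Qed.

Lemma sip0l h : S h -> b 0 h = 0.
Proof. by move=> Sh; have := sipD (sip0 sb) (sip0 sb) Sh; rewrite addr0; lra. Qed.

Lemma sipZ a f h : S f -> S h -> b (a *: f) h = a * b f h.
Proof.
move=> Sf Sh; rewrite -[a *: f]addr0 (sip_linear sb)//; last exact: sip0 sb.
by rewrite sip0l// addr0.
Qed.

Lemma sipB f g h : S f -> S g -> S h -> b (f - g) h = b f h - b g h.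
Proof.
move=> Sf Sg Sh; rewrite -scaleN1r sipD ?sipZ ?mulN1r//; exact: sip_memZ.
Qed.

Lemma sip_sum (e : nat -> V) (c : nat -> R) n h : (forall k, S (e k)) -> S h ->
  b (\sum_(k < n) c k *: e k) h = \sum_(k < n) c k * b (e k) h.
Proof.
move=> Se Sh; elim: n => [|n ih]; first by rewrite !big_ord0 sip0l.
rewrite !big_ord_recr/= sipD ?sipZ ?ih//; first exact: sip_mem_sum.
exact: sip_memZ.
Qed.

Lemma sip_sqrD f g : S f -> S g ->
  b (f + g) (f + g) = b f f + 2 * b f g + b g g.
Proof.
move=> Sf Sg; have Sfg := sip_memD Sf Sg.
rewrite sipD// (sipC sb Sf Sfg) (sipC sb Sg Sfg) !sipD// (sipC sb Sg Sf); ring.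
Qed.

Lemma sip_sqrZ a f : S f -> b (a *: f) (a *: f) = a ^+ 2 * b f f.
Proof.
by move=> Sf; have Saf := sip_memZ a Sf; rewrite sipZ// (sipC sb Sf Saf) sipZ//; ring.
Qed.

Lemma sip_sqrB f g : S f -> S g ->
  b (f - g) (f - g) = b f f - 2 * b f g + b g g.
Proof.
move=> Sf Sg; have SNg := sip_memZ (-1) Sg; rewrite -scaleN1r sip_sqrD//.
by rewrite sip_sqrZ// (sipC sb Sf SNg) sipZ// (sipC sb Sg Sf); ring.
Qed.

Lemma sip_parallelogram f g : S f -> S g ->
  b (f + g) (f + g) + b (f - g) (f - g) = 2 * b f f + 2 * b g g.
Proof. by move=> Sf Sg; rewrite sip_sqrD// sip_sqrB//; ring. Qed.

Lemma sip_sqrD_le f g : S f -> S g ->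
  b (f + g) (f + g) <= 2 * b f f + 2 * b g g.
Proof.
move=> Sf Sg; rewrite -sip_parallelogram// lerDl.
exact/(sip_ge0 sb)/sip_memB.
Qed.

Lemma sip_sqrBC f g : S f -> S g -> b (f - g) (f - g) = b (g - f) (g - f).
Proof. by move=> Sf Sg; rewrite !sip_sqrB// (sipC sb Sg Sf); ring. Qed.

Lemma sip_sqrB_le f g h : S f -> S g -> S h ->
  b (f - h) (f - h) <= 2 * b (f - g) (f - g) + 2 * b (g - h) (g - h).
Proof.
move=> Sf Sg Sh; rewrite -(subrKA g f (- h)).
by apply: sip_sqrD_le; exact: sip_memB.
Qed.

(** The polynomial t |-> b (f - t g) (f - t g) is nonnegative; evaluate it at its
    minimum. *)
Lemma sip_cauchy_schwarz f g : S f -> S g -> b f g ^+ 2 <= b f f * b g g.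
Proof.
move=> Sf Sg.
have q (t : R) : 0 <= b f f - 2 * t * b f g + t ^+ 2 * b g g.
  have := sip_ge0 sb (sip_memB Sf (sip_memZ t Sg)).
  rewrite sip_sqrB//; last exact: sip_memZ.
  by rewrite (sipC sb Sf (sip_memZ t Sg)) sipZ// (sipC sb Sg Sf) sip_sqrZ// mulrA.
have [gg0|gg0] := eqVneq (b g g) 0.
  (* The polynomial is affine in t: this forces b f g = 0, since otherwise it
     takes the value - 1 at the point chosen below. *)
  have [->|fg0] := eqVneq (b f g) 0; first by rewrite expr0n mulr_ge0// (sip_ge0 sb).
  have := q ((b f f + 1) / (2 * b f g)).
  rewrite gg0 mulr0 addr0 (_ : 2 * _ * b f g = b f f + 1); first lra.
  by field.
have gg : 0 < b g g by rewrite lt0r gg0 (sip_ge0 sb).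
have := q (b f g / b g g).
rewrite (_ : _ + _ = (b f f * b g g - b f g ^+ 2) / b g g); last by field.
by rewrite pmulr_lge0 ?invr_gt0// subr_ge0.
Qed.

Lemma sip_cvg (x : nat -> V) f g : (forall n, S (x n)) -> S f -> S g ->
  (fun n => b (x n - f) (x n - f)) @ \oo --> (0 : R) ->
  (fun n => b (x n) g) @ \oo --> b f g.
Proof.
move=> Sx Sf Sg xf; apply/cvgrPdist_lt => e e0.
have gg := sip_ge0 sb Sg.
have d0 : 0 < e ^+ 2 / (b g g + 1) by rewrite divr_gt0 ?exprn_gt0//; lra.
move/cvgrPdist_lt : xf => /(_ _ d0); apply: filterS => n; rewrite sub0r normrN.
have Sxf := sip_memB (Sx n) Sf.
rewrite ger0_norm ?(sip_ge0 sb)// ltr_pdivlMr; last lra.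
move=> h; rewrite distrC -sipB// -(@ltr_pXn2r _ 2) ?nnegrE ?normr_ge0 ?ltW//.
rewrite real_normK ?num_real//; apply: le_lt_trans (sip_cauchy_schwarz Sxf Sg) _.
apply: le_lt_trans h; rewrite ler_wpM2l ?(sip_ge0 sb)//; lra.
Qed.

End semi_inner_product_theory.

Lemma hilbert_semi_inner (R : realType) (V : lmodType R) (S : set V) b :
  hilbert_space S b -> semi_inner_product S b.
Proof. by case=> *; split. Qed.

Lemma semi_inner_sub (R : realType) (V : lmodType R) (S T : set V) b :
  S 0 -> (forall (a : R) f g, S f -> S g -> S (a *: f + g)) -> S `<=` T ->
  semi_inner_product T b -> semi_inner_product S b.
Proof.
move=> S0 SZD ST [T0 TZD TC TL Tge0]; split => //.
- by move=> f g /ST Tf /ST Tg; exact: TC.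
- by move=> a f g h /ST Tf /ST Tg /ST Th; exact: TL.
- by move=> f /ST; exact: Tge0.
Qed.

(** * Lower semicontinuous forms on a Hilbert space are bounded *)

Section lsc_form_bounded.
Context (R : realType) (V : lmodType R) (S : set V) (ip b : V -> V -> R).
Hypothesis hS : hilbert_space S ip.
Hypothesis sb : semi_inner_product S b.
Hypothesis lsc : forall (x : nat -> V) f K, (forall n, S (x n)) -> S f ->
  (fun n => ip (x n - f) (x n - f)) @ \oo --> (0 : R) ->
  (forall n, b (x n) (x n) <= K) -> b f f <= K.

Let sip := hilbert_semi_inner hS.

(* Lower semicontinuity in terms of balls rather than sequences. *)
Let superlevel_open f K : S f -> K < b f f ->
  exists2 e, 0 < e & forall g, S g -> ip (g - f) (g - f) <= e -> K < b g g.
Proof.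
move=> Sf Kf; apply: contrapT => noe.
have /choice[x xP] (n : nat) :
    exists g, [/\ S g, ip (g - f) (g - f) <= n.+1%:R^-1 & b g g <= K].
  apply: contrapT => nog; apply: noe; exists n.+1%:R^-1 => // g Sg gf.
  by rewrite ltNge; apply/negP => bK; apply: nog; exists g.
suff : b f f <= K by rewrite leNgt Kf.
apply: (lsc (x := x)) => // [n||n]; [by case: (xP n)| |by case: (xP n)].
apply: (@squeeze_cvgr _ _ _ _ (cst 0) (fun n => n.+1%:R^-1)).
- apply: nearW => n; have [Sx xf _] := xP n.
  by rewrite xf andbT (sip_ge0 sip)//; exact: (sip_memB sip).
- exact: cvg_cst.
- exact: cvg_harmonic.
Qed.

Let small_large : ~ (exists M, forall f, S f -> b f f <= M * ip f f) ->
  forall e K, 0 < e -> exists h, [/\ S h, ip h h <= e & K < b h h].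
Proof.
move=> unb e K e0.
have [f Sf fP] : exists2 f, S f & (`|K| + 1) / e * ip f f < b f f.
  apply: contrapT => nof; apply: unb; exists ((`|K| + 1) / e) => f Sf.
  by rewrite leNgt; apply/negP => bK; apply: nof; exists f.
have f0 : 0 < ip f f.
  rewrite lt0r (sip_ge0 sip)// andbT; apply/eqP => /(hilbert_ip_eq0 hS Sf) f0.
  move: fP; rewrite f0 (sip0l sip) ?(sip0l sb) ?mulr0 ?ltxx//; exact: (sip0 sip).
have ef : 0 <= e / ip f f by rewrite ltW// divr_gt0.
(* Both forms are homogeneous of degree 2: f is rescaled to ip h h = e. *)
exists (Num.sqrt (e / ip f f) *: f); split.
- exact: (sip_memZ sip).
- by rewrite (sip_sqrZ sip)// sqr_sqrtr// divfK// gt_eqF.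
- rewrite (sip_sqrZ sb)// sqr_sqrtr//; apply: (@le_lt_trans _ _ `|K|).
    exact: ler_norm.
  apply: (@lt_le_trans _ _ (`|K| + 1)); first lra.
  rewrite (_ : `|K| + 1 = e / ip f f * ((`|K| + 1) / e * ip f f)).
    by rewrite ler_wpM2l// ltW.
  by field; rewrite !gt_eqF.
Qed.

(* By the parallelogram identity b takes a value at least b h h at f + h or at
   f - h, and [small_large] provides a small h with b h h large.  The bound n holds on
   a ball of squared radius 4 p'.2, larger than the one recorded: the limit of
   the centres is only controlled up to the factors 2 of [sip_sqrB_le]. *)
Let next_ball : ~ (exists M, forall f, S f -> b f f <= M * ip f f) ->
  forall (n : nat) (p : V * R), exists p' : V * R, S p.1 -> 0 < p.2 ->
    [/\ S p'.1, 0 < p'.2, p'.2 <= p.2 / 4,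
        ip (p'.1 - p.1) (p'.1 - p.1) <= p.2 / 4 &
        forall g, S g -> ip (g - p'.1) (g - p'.1) <= 4 * p'.2 -> n%:R < b g g].
Proof.
move=> unb n [f e]/=; have [[Sf e0]|nSe] := pselect (S f /\ 0 < e); last first.
  by exists (f, e) => Sf e0; case: nSe.
have e4 : 0 < e / 4 by lra.
have [h [Sh he hn]] := small_large unb n%:R e4.
have [f' [Sf' f'f f'n]] :
    exists f', [/\ S f', ip (f' - f) (f' - f) <= e / 4 & n%:R < b f' f'].
  have := sip_parallelogram sb Sf Sh; have := sip_ge0 sb Sf.
  have [fhn _ _|nfh f_ge0 fh] := ltP n%:R (b (f + h) (f + h)).
    by exists (f + h); split => //; [exact: (sip_memD sip)|rewrite [f + h]addrC addrK].
  exists (f - h); split; [exact: (sip_memB sip)| |lra].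
  by rewrite [f - h]addrC addrK -scaleN1r (sip_sqrZ sip)// sqrrN expr1n mul1r.
have [r r0 rP] := superlevel_open Sf' f'n.
exists (f', Num.min (r / 4) (e / 4)) => _ _ /=; split => //.
- by rewrite lt_min e4 andbT; lra.
- by rewrite ge_min lexx orbT.
- move=> g Sg gf'; apply: rP => //; apply: le_trans gf' _.
  have : Num.min (r / 4) (e / 4) <= r / 4 by rewrite ge_min lexx.
  lra.
Qed.

(** If b were unbounded, [next_ball] would give a sequence of nested balls with
    b > n on the n-th one; their centres form a Cauchy sequence, and b would be
    infinite at the limit. *)
Lemma lsc_form_bounded : exists M, forall f, S f -> b f f <= M * ip f f.
Proof.
apply: contrapT => unb.
have /choice[F FP] (np : nat * (V * R)) := next_ball unb np.1 np.2.
pose p := fix p n := if n is m.+1 then F (m, p m) else (0, 1) : V * R.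
pose x n := (p n).1; pose e n := (p n).2.
have Sp n : S (x n) /\ 0 < e n.
  elim: n => [|n [Sx e0]]; first by split; [exact: (sip0 sip)|exact: ltr01].
  by have [] := FP (n, p n) Sx e0.
have Sx n : S (x n) by case: (Sp n).
have e_gt0 n : 0 < e n by case: (Sp n).
have eS n : e n.+1 <= e n / 4 by have [] := FP (n, p n) (Sx n) (e_gt0 n).
have xS n : ip (x n.+1 - x n) (x n.+1 - x n) <= e n / 4.
  by have [] := FP (n, p n) (Sx n) (e_gt0 n).
have xb n g : S g -> ip (g - x n.+1) (g - x n.+1) <= 4 * e n.+1 -> n%:R < b g g.
  by have [_ _ _ _] := FP (n, p n) (Sx n) (e_gt0 n); apply.
have nested n k g : S g -> ip (g - x (n + k)%N) (g - x (n + k)%N) <= e (n + k)%N ->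
    ip (g - x n) (g - x n) <= e n.
  move=> Sg; elim: k => [|k ih]; rewrite ?addn0// addnS => gx; apply: ih.
  apply: le_trans (sip_sqrB_le sip Sg (Sx (n + k).+1) (Sx (n + k)%N)) _.
  have := eS (n + k)%N; have := xS (n + k)%N; move: gx; lra.
have xx m n : (n <= m)%N -> ip (x m - x n) (x m - x n) <= e n.
  move=> nm; apply: (nested n (m - n)%N) => //; rewrite subnKC//.
  by rewrite subrr (sip0l sip) ?ltW//; exact: (sip0 sip).
have e_harm n : e n <= n.+1%:R^-1.
  elim: n => [|n ih]; first by rewrite invr1 /e/=.
  apply: le_trans (eS n) _; apply: (@le_trans _ _ (n.+1%:R^-1 / 4)).
    by rewrite ler_wpM2r.
  rewrite -invfM lef_pV2 ?posrE ?mulr_gt0// -natrM ler_nat; lia.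
have e_cvg : e @ \oo --> (0 : R).
  apply: (@squeeze_cvgr _ _ _ _ (cst 0) (fun n => n.+1%:R^-1)).
  - by apply: nearW => n; rewrite e_harm ltW.
  - exact: cvg_cst.
  - exact: cvg_harmonic.
have [d d0|f Sf xf] := hilbert_complete hS Sx.
  have d4 : 0 < d / 4 by lra.
  move/cvgrPdist_lt : e_cvg => /(_ _ d4)[N _ eN]; exists N => m n Nm Nn.
  have := eN N (leqnn N); rewrite /= sub0r normrN ger0_norm 1?ltW// => eNd.
  apply: le_lt_trans (sip_sqrB_le sip (Sx m) (Sx N) (Sx n)) _.
  have := xx m N Nm; have := xx n N Nn.
  rewrite (sip_sqrBC sip (Sx n) (Sx N)); lra.
(* The index m = maxn N n.+1 makes x m close to f while inside the ball n.+1. *)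
have fb n : n%:R < b f f.
  apply: (xb n) => //; move/cvgrPdist_lt : xf => /(_ _ (e_gt0 n.+1))[N _ xN].
  have := xN (maxn N n.+1) (leq_maxl _ _); rewrite /= sub0r normrN => xfe.
  have xfe' := le_lt_trans (ler_norm _) xfe.
  apply: le_trans (sip_sqrB_le sip Sf (Sx (maxn N n.+1)) (Sx n.+1)) _.
  rewrite (sip_sqrBC sip Sf (Sx _)).
  have := xx (maxn N n.+1) n.+1 (leq_maxr _ _); lra.
have bn := archi_boundP (sip_ge0 sb Sf); set n := Num.bound _ in bn.
by have := lt_trans (fb n) bn; rewrite ltxx.
Qed.

End lsc_form_bounded.

(** * Orthonormal expansions *)

Lemma cvg_eventually_cst (R : realType) (u : nat -> R) l c :
  u @ \oo --> l -> (\forall n \near \oo, u n = c) -> l = c.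
Proof.
move=> ul uc; rewrite -(cvg_lim (@norm_hausdorff _ _) ul).
by apply: (cvg_lim (@norm_hausdorff _ _)); exact: cvg_near_cst.
Qed.

Section fourier_expansion.
Context (R : realType) (V : lmodType R) (S : set V) (ip : V -> V -> R).
Context (w : nat -> V).
Hypothesis hS : hilbert_space S ip.
Hypothesis w_con : complete_orthonormal S ip w.

Let sip := hilbert_semi_inner hS.
Let Sw n : S (w n). Proof. by case: w_con. Qed.
Let ww m n : ip (w m) (w n) = (m == n)%:R. Proof. by case: w_con. Qed.

(** The second form b may live on a larger space T: this serves both for ip itself
    and for the L_2 product on a Hilbert space contained in L_2. *)
Lemma bounded_form_expansion (T : set V) b M f g :
  semi_inner_product T b -> S `<=` T ->
  (forall h, S h -> b h h <= M * ip h h) -> S f -> T g ->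
  series (fun k => ip f (w k) * b (w k) g) @ \oo --> b f g.
Proof.
move=> sT ST bM Sf Tg.
pose s n := \sum_(k < n) ip f (w k) *: w k.
have Ss n : S (s n) by exact: (sip_mem_sum sip (fun k => ip f (w k)) n Sw).
rewrite (_ : series _ = fun n => b (s n) g); last first.
  apply/funext => n; rewrite seriesEord/=.
  by rewrite (sip_sum sT (e := w) (fun k => ip f (w k)))// => k; exact: ST.
have [_ _ /(_ f Sf) fs] := w_con.
apply: (sip_cvg sT (x := s)) => //; [by move=> n; exact: ST|exact: ST|].
apply: (@squeeze_cvgr _ _ _ _ (cst 0)
  (fun n => M * ip (f - s n) (f - s n))); last 2 first.
- exact: cvg_cst.
- by rewrite -(mulr0 M); apply: cvgMr.
apply: nearW => n; have Sfs := sip_memB sip (Ss n) Sf.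
by rewrite (sip_ge0 sT) ?(sip_sqrBC sip Sf)//=; [exact: bM|exact: ST].
Qed.

Lemma bounded_form_coef (T : set V) b M f g n :
  semi_inner_product T b -> S `<=` T ->
  (forall h, S h -> b h h <= M * ip h h) -> S f -> T g ->
  (forall k, k != n -> b (w k) g = 0) -> b f g = ip f (w n) * b (w n) g.
Proof.
move=> sT ST bM Sf Tg g0.
apply: (cvg_eventually_cst (bounded_form_expansion sT ST bM Sf Tg)).
near=> m; have nm : (n < m)%N by near: m; exact: nbhs_infty_gt.
rewrite seriesEord/= (bigD1 (Ordinal nm))//= big1 ?addr0// => k kn.
by rewrite g0 ?mulr0.
Unshelve. all: by end_near. Qed.

Lemma parseval f g : S f -> S g ->
  series (fun k => ip f (w k) * ip g (w k)) @ \oo --> ip f g.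
Proof.
move=> Sf Sg; have -> : (fun k => ip f (w k) * ip g (w k)) =
    (fun k => ip f (w k) * ip (w k) g).
  by apply/funext => k; rewrite (hilbert_ipC hS Sg (Sw k)).
by apply: (bounded_form_expansion (M := 1) sip) => // h; rewrite mul1r.
Qed.

(** The partial sums of the series of the c k w_k are Cauchy because those of the
    c k ^+ 2 are, and completeness provides the limit. *)
Lemma riesz_fischer (c : nat -> R) : cvgn (series (fun k => c k ^+ 2)) ->
  exists2 f, S f & forall n, ip f (w n) = c n.
Proof.
move=> cc; pose s n := \sum_(k < n) c k *: w k.
have Ss n : S (s n) by exact: (sip_mem_sum sip c n Sw).
have sw n m : ip (s n) (w m) = c m *+ (m < n)%N.
  rewrite (sip_sum sip c n Sw)//; case: ltnP => [mn|nm].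
    rewrite (bigD1 (Ordinal mn))//= ww eqxx mulr1 big1 ?addr0// => k km.
    by rewrite ww (_ : (_ == _) = false) ?mulr0//; exact/negbTE.
  by rewrite big1// => k _; rewrite ww ltn_eqF ?mulr0// (leq_trans (ltn_ord k)).
have ss m n : (n <= m)%N -> ip (s n) (s m) = series (fun k => c k ^+ 2) n.
  move=> nm; rewrite (sip_sum sip c n Sw)// seriesEord/=; apply: eq_bigr => k _.
  by rewrite (hilbert_ipC hS)// sw (leq_trans (ltn_ord k) nm) mulr1n expr2.
have ssB m n : (n <= m)%N -> ip (s m - s n) (s m - s n) =
    series (fun k => c k ^+ 2) m - series (fun k => c k ^+ 2) n.
  move=> nm; rewrite (sip_sqrB sip)// (hilbert_ipC hS (Ss m) (Ss n)) !ss//; ring.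
have [e e0|f Sf sf] := hilbert_complete hS Ss; last first.
  exists f => // n.
  apply: (cvg_eventually_cst (sip_cvg sip Ss Sf (Sw n) sf)); near=> m.
  by rewrite sw (_ : (n < m)%N)//; near: m; exact: nbhs_infty_gt.
move/cvg_ex : cc => [l cl].
have e2 : 0 < e / 2 by lra.
move/cvgrPdist_lt : cl => /(_ _ e2)[N _ cN]; exists N.
have dist m n : (N <= m)%N -> (N <= n)%N ->
    series (fun k => c k ^+ 2) m - series (fun k => c k ^+ 2) n < e.
  move=> /cN/=; rewrite ltr_norml => /andP[m1 m2] /cN/=.
  by rewrite ltr_norml => /andP[n1 n2]; lra.
move=> m n Nm Nn; have [nm|/ltnW mn] := leqP n m; first by rewrite ssB// dist.
by rewrite (sip_sqrBC sip)// ssB// dist.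
Unshelve. all: by end_near. Qed.

End fourier_expansion.

(** * The space L_2 of a subset of R^d *)

Section L2_space.
Context (R : realType) (d : nat) (Om : set 'rV[R]_d).
Local Notation mu := (lebesgue_rV R d).
Implicit Types f g : 'rV[R]_d -> R.

Lemma restrict_linear (a : R) f g :
  (a *: f + g) \_ Om = a *: (f \_ Om) + (g \_ Om).
Proof.
apply/funext => x; rewrite patchE !fctE !patchE; case: ifPn => // _.
by rewrite scaler0 addr0.
Qed.

Lemma restrictM f g : (fun x => f x * g x) \_ Om = (f \_ Om) \* (g \_ Om).
Proof.
by apply/funext => x; rewrite /= !patchE; case: ifPn => // _; rewrite mulr0.
Qed.

(** Membership in [L2] speaks of the extension by zero, so integrals over Om are
    turned into integrals of such extensions over R^d. *)
Lemma L2_ipE f g : L2_ip Om f g = \int[mu]_x ((f \_ Om) x * (g \_ Om) x).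
Proof. by rewrite /L2_ip Rintegral_mkcond restrictM. Qed.

Lemma L2_ip_restrictl f g : L2_ip Om (f \_ Om) g = L2_ip Om f g.
Proof. by rewrite !L2_ipE -patch_setI setIid. Qed.

Lemma L2_mul_integrable f g : L2 Om f -> L2 Om g ->
  mu.-integrable setT (EFin \o (fun x => (f \_ Om) x * (g \_ Om) x)).
Proof. by move=> Lf Lg; apply/Lfun1_integrable; exact: Lfun2_mul_Lfun1. Qed.

Lemma L2_semi_inner : semi_inner_product (L2 Om) (L2_ip Om).
Proof.
have p1 : (1 <= 2%:E :> \bar R)%E by rewrite lee_fin ler1n.
have [L0 LZD] := Lfun_submod_closed mu p1.
have memZD a f g : L2 Om f -> L2 Om g -> L2 Om (a *: f + g).
  by move=> Lf Lg; rewrite /L2/= restrict_linear; exact: LZD.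
split => //.
- rewrite /L2/= (_ : _ \_ _ = 0)//; apply/funext => x.
  by rewrite patchE; case: ifP.
- by move=> f g _ _; apply: eq_Rintegral => x _; rewrite mulrC.
- move=> a f g h Lf Lg Lh; rewrite !L2_ipE restrict_linear.
  rewrite -RintegralZl//; last exact: L2_mul_integrable.
  rewrite -RintegralD//; last exact: L2_mul_integrable.
    by apply: eq_Rintegral => x _; rewrite !fctE mulrDl -mulrA.
  exact: (integrableZl measurableT a (L2_mul_integrable Lf Lh)).
- by move=> f _; apply: Rintegral_ge0 => x _; rewrite -expr2 sqr_ge0.
Qed.

(** The integrand is written as a square, and the integral is taken in the
    extended reals, as in the lemma of Fatou and in the criterion for a
    function to vanish almost everywhere. *)
Lemma L2_ipEe f : L2 Om f ->
  (L2_ip Om f f)%:E = (\int[mu]_x (((f \_ Om) x) ^+ 2)%:E)%E.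
Proof.
move=> Lf; rewrite L2_ipE /Rintegral fineK.
  by apply: eq_integral => x _; rewrite expr2.
exact/integrable_fin_num/L2_mul_integrable.
Qed.

Lemma L2_sqr_measurable f : L2 Om f ->
  measurable_fun setT (EFin \o (fun x => ((f \_ Om) x) ^+ 2)).
Proof.
by move=> Lf; have /integrableP[] := L2_mul_integrable Lf Lf.
Qed.

Lemma L2_ip_eq0_ae f : L2 Om f -> L2_ip Om f f = 0 ->
  {ae mu, forall x, Om x -> f x = 0}.
Proof.
move=> Lf ff0; have := L2_ipEe Lf; rewrite ff0 => /esym f0.
have /ae_eq_integral_abs : measurable_fun setT (EFin \o (fun x => ((f \_ Om) x) ^+ 2)).
  exact: L2_sqr_measurable.
move=> /(_ mu measurableT)[+ _]; have -> : (\int[mu]_x `|(((f \_ Om) x) ^+ 2)%:E|)%E = 0%E.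
  by apply: etrans f0; apply: eq_integral => x _; rewrite gee0_abs// lee_fin sqr_ge0.
move=> /(_ erefl); apply: filterS => x /(_ I) + Omx.
by rewrite /= patchE mem_set// => -[] /eqP; rewrite sqrf_eq0 => /eqP.
Qed.

(** Pointwise values are what convergence in H and the L_2 norm have in common;
    this is where the former becomes a bound on the latter. *)
Lemma L2_fatou (u : nat -> 'rV[R]_d -> R) f K : (forall n, L2 Om (u n)) ->
  L2 Om f -> (forall x, Om x -> u n x @[n --> \oo] --> f x) ->
  (forall n, L2_ip Om (u n) (u n) <= K) -> L2_ip Om f f <= K.
Proof.
move=> Lu Lf uf uK; rewrite -lee_fin L2_ipEe//.
pose F n x := (((u n \_ Om) x) ^+ 2)%:E.
have -> : (\int[mu]_x (((f \_ Om) x) ^+ 2)%:E = \int[mu]_x limn_einf (F ^~ x))%E.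
  apply: eq_integral => x _; apply/esym; apply: (cvg_limn_einf_sup _).1.
  apply: cvg_EFin; first by apply: nearW.
  have ux : (fun n => (u n \_ Om) x) @ \oo --> (f \_ Om) x.
    rewrite patchE; case: ifPn => [/set_mem Omx|nOmx].
      by under eq_fun do rewrite patchE mem_set//; exact: uf.
    by under eq_fun do rewrite patchE (negbTE nOmx); exact: cvg_cst.
  rewrite expr2; apply: cvg_trans (cvgM ux ux); apply: near_eq_cvg.
  by apply: nearW => n; rewrite /= expr2.
apply: le_trans.
  apply: fatou => //[n|n x _]; [exact: L2_sqr_measurable|].
  by rewrite lee_fin sqr_ge0.
rewrite limn_einf_lim; apply: lime_le; first exact: is_cvg_einfs.
apply: nearW => n; apply: (@le_trans _ _ (\int[mu]_x F n x)%E).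
  by apply: ereal_inf_lbound; exists n => /=.
by rewrite -L2_ipEe// lee_fin.
Qed.

End L2_space.

(** * The native space and the weighted spaces *)

(** A convergent series has bounded terms, so rho_n^-1 = O(lam_n^-1). *)
Lemma L2w_sub (R : realType) (d : nat) (Om : set 'rV[R]_d) v (lam rho : nat -> R) :
  (forall n, 0 < lam n) -> (forall n, 0 < rho n) ->
  cvgn (series (fun n => lam n * (rho n)^-1)) -> L2w Om v lam `<=` L2w Om v rho.
Proof.
move=> lam0 rho0 /cvg_series_cvg_0 q0 f [Lf fl]; split => //.
have [B B_ub] : has_ubound (range (fun n => lam n * (rho n)^-1)).
  by apply/bounded_fun_has_ubound/cvg_seq_bounded/cvg_ex; exists 0.
have qB n : lam n / rho n <= B by apply: B_ub; exists n.
apply: (@series_le_cvg _ _ (fun n => B * (L2_ip Om f (v n) ^+ 2 * (lam n)^-1))).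
- by move=> n; rewrite mulr_ge0 ?sqr_ge0// invr_ge0 ltW.
- move=> n; apply: mulr_ge0; last by rewrite mulr_ge0 ?sqr_ge0// invr_ge0 ltW.
  by apply: le_trans (qB n); rewrite divr_ge0// ltW.
- move=> n; rewrite mulrCA ler_wpM2l ?sqr_ge0// ler_pdivlMr//.
  by rewrite mulrC qB.
- exact: is_cvg_seriesZ.
Qed.

Section native_space_theory.
Context (R : realType) (d : nat) (Om : set 'rV[R]_d)
  (C : 'rV[R]_d -> 'rV[R]_d -> R) (H : set ('rV[R]_d -> R))
  (ip : ('rV[R]_d -> R) -> ('rV[R]_d -> R) -> R).
Hypothesis nH : native_space Om C H ip.

Let hH := native_hilbert nH.
Let sH := hilbert_semi_inner hH.

(** Evaluation at x is the inner product with C x. *)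
Lemma native_cvg_pointwise (u : nat -> 'rV[R]_d -> R) f : (forall n, H (u n)) ->
  H f -> (fun n => ip (u n - f) (u n - f)) @ \oo --> (0 : R) ->
  forall x, Om x -> u n x @[n --> \oo] --> f x.
Proof.
move=> Hu Hf uf x Omx.
rewrite -(native_reproducing nH Omx Hf).
under eq_fun do rewrite -(native_reproducing nH Omx (Hu _)).
exact: (sip_cvg sH Hu Hf (native_kernel nH Omx) uf).
Qed.

(** The closed graph theorem for the inclusion of H in L_2: the L_2 norm is lower
    semicontinuous on H by Fatou, and finite everywhere. *)
Lemma native_L2_bounded : H `<=` L2 Om ->
  exists M, forall f, H f -> L2_ip Om f f <= M * ip f f.
Proof.
move=> HL; apply: (lsc_form_bounded hH).
  exact: semi_inner_sub (sip0 sH) (sipZD sH) HL (L2_semi_inner Om).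
move=> u f K Hu Hf uf uK; apply: (L2_fatou (u := u)) => //.
- by move=> n; exact: HL.
- exact: HL.
- exact: native_cvg_pointwise uf.
Qed.

Context (v : nat -> 'rV[R]_d -> R) (lam : nat -> R).
Hypothesis v_basis : complete_orthonormal (L2 Om) (L2_ip Om) v.
Hypothesis lam_gt0 : forall n, 0 < lam n.
Local Notation w := (fun n => (Num.sqrt (lam n) *: v n) \_ Om).
Hypothesis w_basis : complete_orthonormal H ip w.
Hypothesis HL : H `<=` L2 Om.

Let sL := L2_semi_inner Om.

(** Continuity of the inclusion in L_2 allows the expansion of f on w to be paired
    with v_n term by term, and only the n-th term survives. *)
Lemma native_L2_coef f n : H f ->
  L2_ip Om f (v n) = Num.sqrt (lam n) * ip f (w n).
Proof.
move=> Hf; have [M MP] := native_L2_bounded HL; have [Lv vv _] := v_basis.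
have wv k : L2_ip Om (w k) (v n) = Num.sqrt (lam k) * (k == n)%:R.
  by rewrite L2_ip_restrictl (sipZ sL)// vv.
rewrite (bounded_form_coef (n := n) hH w_basis sL HL MP Hf (Lv n)).
  by rewrite [in LHS]wv eqxx mulr1 mulrC.
by move=> k kn; rewrite wv (negbTE kn) mulr0.
Qed.

Lemma native_space_is_L2w : space_is_L2w Om v lam H ip.
Proof.
have sqrt_lam n : Num.sqrt (lam n) != 0 by rewrite gt_eqF// sqrtr_gt0.
have coefM f g n : H f -> H g ->
    L2_ip Om f (v n) * L2_ip Om g (v n) * (lam n)^-1 = ip f (w n) * ip g (w n).
  move=> Hf Hg; rewrite !native_L2_coef// -[in (lam n)^-1](sqr_sqrtr (ltW (lam_gt0 n))).
  by field.
have expand f g : H f -> H g -> series (fun n =>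
    L2_ip Om f (v n) * L2_ip Om g (v n) * (lam n)^-1) @ \oo --> ip f g.
  move=> Hf Hg; rewrite (_ : (fun _ => _) = (fun n => ip f (w n) * ip g (w n))).
    exact: (parseval hH w_basis Hf Hg).
  by apply/funext => n; exact: coefM.
split => [f Hf|f g Hf Hg|f [Lf fl]].
- split; first exact: HL.
  by apply/cvg_ex; exists (ip f f); exact: expand.
- by rewrite /L2w_ip; apply/esym/cvg_lim => //; exact: expand.
(* The element of H whose coefficients on w are those that f would have; it has
   the same coefficients as f on v, and v is complete in L_2. *)
- have [|g Hg gw] := riesz_fischer hH w_basis
    (c := fun n => L2_ip Om f (v n) / Num.sqrt (lam n)).
    under eq_fun do rewrite expr_div_n (sqr_sqrtr (ltW (lam_gt0 _))).
    exact: fl.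
  exists g => //; have Lfg := sip_memB sL Lf (HL Hg); have [Lv _ vc] := v_basis.
  have fg0 n : L2_ip Om (f - g) (v n) = 0.
    rewrite (sipB sL)//; last exact: HL.
    by rewrite (native_L2_coef n Hg) gw mulrCA divff// mulr1 subrr.
  have fg_ip0 : L2_ip Om (f - g) (f - g) = 0.
    apply/esym/(cvg_eventually_cst (vc _ Lfg)); apply: nearW => n /=.
    by rewrite big1 ?subr0// => k _; rewrite fg0 scale0r.
  apply: filterS (L2_ip_eq0_ae Lfg fg_ip0) => x fgx /fgx /eqP.
  by rewrite subr_eq0 => /eqP.
Qed.

End native_space_theory.

Theorem theorem9 (R : realType) (d : nat) (Om : set 'rV[R]_d)
  (C : 'rV[R]_d -> 'rV[R]_d -> R)
  (H : set ('rV[R]_d -> R)) (ip : ('rV[R]_d -> R) -> ('rV[R]_d -> R) -> R)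
  (v : nat -> 'rV[R]_d -> R) (lam rho : nat -> R)
  (Om_domain : bounded_domain Om)
  (C_continuous : {within Om `*` Om, continuous (fun p => C p.1 p.2)})
  (C_sym : forall x y, Om x -> Om y -> C x y = C y x)
  (C_pd : positive_definite_kernel Om C)
  (H_native : native_space Om C H ip)
  (v_basis : complete_orthonormal (L2 Om) (L2_ip Om) v)
  (lam_gt0 : forall n, 0 < lam n)
  (rho_gt0 : forall n, 0 < rho n)
  (w_basis : complete_orthonormal H ip
     (fun n => (Num.sqrt (lam n) *: v n) \_ Om))
  (sum_lam_rho : cvgn (series (fun n => lam n * (rho n)^-1))) :
  L2w Om v lam `<=` L2w Om v rho /\
  (H `<=` L2 Om -> space_is_L2w Om v lam H ip /\ H `<=` L2w Om v rho).
Proof.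
split=> [|HL]; first exact: L2w_sub.
have HE := native_space_is_L2w H_native v_basis lam_gt0 w_basis HL.
by split=> //; case: HE => HLw _ _; apply: subset_trans HLw _; exact: L2w_sub.
Qed.
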